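(* For each $m\ge 1$ and $n\ge 0$ (integers), $(m,n)\text{-niRPDA} \subsetneq (m,n+1)\text{-niRPDA}$.
   Context: Alphabets are finite nonempty sets; $\varepsilon$ denotes the empty string. A realtime pushdown automaton is $M=(Q,\Sigma,\Gamma,\delta,q_0,Z_0,F)$ with finite state set $Q$, input alphabet $\Sigma$, pushdown alphabet $\Gamma$, initial state $q_0\in Q$, initial pushdown symbol $Z_0\in\Gamma$, accepting states $F\subseteq Q$, and transition function $\delta$ from $Q\times\Gamma\times\Sigma$ to finite subsets of $Q\times\Gamma^*$ with $|\delta(q,A,a)|\le 1$ for all $q\in Q$, $A\in\Gamma$, $a\in\Sigma$ (so it is deterministic and has no $\varepsilon$-transitions). Configurations are triples $(q,\gamma,\sigma)\in Q\times\Gamma^*\times\Sigma^*$ (state, pushdown content with the top as the rightmost symbol, unread input). The step relation is $(q,\gamma A,a\sigma)\vdash(p,\gamma w,\sigma)$ whenever $(p,w)\in\delta(q,A,a)$; $\vdash^*$ is its reflexive and transitive closure. Acceptance is by final state and empty pushdown: $L(M)=\{w\in\Sigma^*\mid(q_0,Z_0,w)\vdash^*(f,\varepsilon,\varepsilon)\text{ for some }f\in F\}$. For one-state (stateless) automata, i.e. $|Q|=1$, an initial pushdown string $\alpha\in\Gamma^+$ is allowed in place of the initial pushdown symbol $Z_0$. An $m$-state automaton is one with $|Q|=m$. A pushdown automaton with input alphabet $\Sigma$ and pushdown alphabet $\Gamma$ is called $n$-non-input-pushdown-alphabet-limited if $|\Gamma|-|\Sigma|\le n$. The family $(m,n)\text{-niRPDA}$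 consists of all languages accepted by an $m$-state realtime pushdown automaton with $n$ non-input pushdown symbols, i.e. one that is $n$-non-input-pushdown-alphabet-limited. *)

(* Defs.v *)
From Stdlib Require Import Relation_Operators.
From mathcomp Require Import all_boot finmap classical_sets.

Set Implicit Arguments.
Unset Strict Implicit.
Unset Printing Implicit Defensive.

Local Open Scope fset_scope.
Local Open Scope classical_set_scope.

(* [initial M] is a single symbol, except that a one-state automaton may start
   with an arbitrary nonempty string.  The states and the pushdown alphabet are
   nonempty because of [start M] and [initial M]. *)
Record rpda (Sigma : finType) := RPDA {
  state : finType;
  stack : finType;
  delta : state -> stack -> Sigma -> {fset (state * seq stack)};
  start : state;
  initial : seq stack;
  final : {set state};
  input_nonempty : 0 < #|Sigma|;
  delta_deterministic : forall q A a, #|` delta q A a| <= 1;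
  initial_shape : if #|state| == 1 then 0 < size initial else size initial == 1
}.

Section Semantics.
Variables (Sigma : finType) (M : rpda Sigma).

(* The top of the pushdown is the last element of the sequence. *)
Definition config : Type := (state M * seq (stack M) * seq Sigma)%type.

Inductive step : config -> config -> Prop :=
| Step q p gamma A w a sigma :
    (p, w) \in delta q A a ->
    step (q, rcons gamma A, a :: sigma) (p, gamma ++ w, sigma).

Definition steps : config -> config -> Prop := clos_refl_trans config step.

Definition accepted : set (seq Sigma) :=
  [set w | exists2 f, f \in final M &
     steps (start M, initial M, w) (f, [::], [::])].

(* The subtraction is truncated, which is harmless against a bound [n : nat]. *)
Definition non_input_limited (n : nat) : Prop := #|stack M| - #|Sigma| <= n.

End Semantics.

(* A language comes with its alphabet: as the number of pushdown symbols is
   compared with [#|Sigma|], adding unused input symbols is not neutral.  So a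
   family of languages is given by its members over each alphabet. *)
Definition language_family := forall Sigma : finType, set (set (seq Sigma)).

Definition family_sub (A B : language_family) : Prop :=
  forall Sigma : finType, A Sigma `<=` B Sigma.

Definition family_proper (A B : language_family) : Prop :=
  family_sub A B /\ ~ family_sub B A.

Definition niRPDA (m n : nat) : language_family := fun Sigma =>
  [set L | exists M : rpda Sigma,
     [/\ #|state M| = m, non_input_limited M n & L = accepted M]].

(* Main.v *)
Require Import Defs.
From mathcomp Require Import all_boot finmap classical_sets.
From mathcomp Require Import zify.
From Stdlib Require Import Relation_Operators Operators_Properties.

(**
A configuration from which some word of length one is accepted has exactly one
pushdown symbol, because a step removes at most one symbol.  So an automaton
with m states and g pushdown symbols has at most m g configurations of this
kind, and its language has at most m g residuals containing a word of length
one.  Conversely, over an alphabet large enough, an automaton with m states and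
g pushdown symbols can attain this bound: one letter runs through all pairs
(state, single symbol), one letter is accepted from all of them, and the
remaining letters tell them apart through the subset of letters accepted there.
*)

Set Implicit Arguments.
Unset Strict Implicit.
Unset Printing Implicit Defensive.

(** Such a set carries the same information as an option, so that the set-valued [delta] can be used
    as a partial function. *)
Lemma mem_fset_ohead (K : choiceType) (A : {fset K}) x :
  #|` A| <= 1 -> (x \in A) = (ohead A == Some x).
Proof.
rewrite -[x \in A]/(x \in enum_fset A).
by case: (enum_fset A) => [|y [|z s]] //= _; rewrite inE eq_sym.
Qed.

Lemma ohead_fset1 (K : choiceType) (x : K) : ohead [fset x]%fset = Some x.
Proof. by apply/eqP; rewrite -mem_fset_ohead ?cardfs1 // inE. Qed.

Section Run.
Variables (Sigma : finType) (M : rpda Sigma).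
Implicit Types (c : state M * seq (stack M)) (u v w : seq Sigma).

Lemma mem_delta q A a (x : state M * seq (stack M)) :
  (x \in delta q A a) = (ohead (delta q A a) == Some x).
Proof. exact/mem_fset_ohead/delta_deterministic. Qed.

(** [belast A s] and [last A s] cut [A :: s] at its right end, where the top is. *)
Definition move_on c a : option (state M * seq (stack M)) :=
  if c.2 is A :: s then
    omap (fun x => (x.1, belast A s ++ x.2)) (ohead (delta c.1 (last A s) a))
  else None.

Fixpoint run c w : option (state M * seq (stack M)) :=
  if w is a :: w' then obind (run^~ w') (move_on c a) else Some c.

Lemma run_cat c u v : run c (u ++ v) = obind (run^~ v) (run c u).
Proof. by elim: u c => //= a u IHu c; case: (move_on c a). Qed.

Lemma step_move_on c w c' w' :
  step (c, w) (c', w') <-> exists2 a, w = a :: w' & move_on c a = Some c'.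
Proof.
split=> [st|[a -> ]].
  inversion st as [q p gamma A x a sigma x_in]; exists a => //=.
  rewrite /move_on; case: gamma {st H H0 H1 H2} => [|B s] /=.
    by move: x_in; rewrite mem_delta => /eqP ->.
  by rewrite last_rcons belast_rcons; move: x_in; rewrite mem_delta => /eqP ->.
case: c => q [|A s] //; rewrite /move_on /=.
case E: (ohead _) => [[p x]|] //= [<-]; rewrite lastI.
by apply: Step; rewrite mem_delta E.
Qed.

Lemma steps_run c w c' : steps (c, w) (c', [::]) <-> run c w = Some c'.
Proof.
split.
  move=> /clos_rt_rt1n_iff; move Ex: (c, w) => x; move Ey: (c', [::]) => y st.
  elim: st c w Ex Ey => {x y} [x c w <- [-> <-] //|x y z xy _ IH c w Ex Ez].
  case: y => c1 w1 in xy IH *; move: xy; rewrite -Ex => /step_move_on[a -> Ea].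
  by rewrite /= Ea /=; apply: IH.
elim: w c => [|a w IHw] c /=; first by move=> [->]; apply: rt_refl.
case E: (move_on c a) => [c1|] //= /IHw; apply: rt_trans; apply: rt_step.
by apply/step_move_on; exists a.
Qed.

Lemma acceptedE w :
  accepted M w <-> exists2 f, f \in final M &
    run (start M, initial M) w = Some (f, [::]).
Proof. by split=> -[f fF /steps_run Hf]; exists f. Qed.

Lemma accepted_rcons u a : accepted M (rcons u a) ->
  exists x : state M * stack M, run (start M, initial M) u = Some (x.1, [:: x.2]).
Proof.
move=> /acceptedE[f _]; rewrite -cats1 run_cat.
case: run => [[q [|A s]]|] //=; rewrite /move_on /=.
(* The last step leaves an empty pushdown, and [belast A s] is empty only if [s] is. *)
case: ohead => [x|] //= [_ ]; case: s => [|B s] //= _.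
by exists (q, A).
Qed.

Lemma accepted_same_run u v w :
  run (start M, initial M) u = run (start M, initial M) v ->
  accepted M (u ++ w) -> accepted M (v ++ w).
Proof.
move=> E /acceptedE[f fF]; rewrite run_cat E -run_cat => Hf.
by apply/acceptedE; exists f.
Qed.

(** Acceptance of [d] after [u i] forces a one-symbol pushdown there. Words that reach the same
    configuration have the same residual, so [sep] makes the map to pairs injective. *)
Lemma card_residuals (I : finType) (u : I -> seq Sigma) (d : Sigma) :
  (forall i, accepted M (rcons (u i) d)) ->
  (forall i j, (forall a, accepted M (rcons (u i) a) <->
                          accepted M (rcons (u j) a)) -> i = j) ->
  #|I| <= #|state M| * #|stack M|.
Proof.
move=> acc sep.
have ex i : exists x : state M * stack M,
    run (start M, initial M) (u i) == Some (x.1, [:: x.2]).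
  by have [x Hx] := accepted_rcons (acc i); exists x; apply/eqP.
pose h i := xchoose (ex i).
rewrite -card_prod; apply: (@leq_card _ _ h) => i j hij.
have runij : run (start M, initial M) (u i) = run (start M, initial M) (u j).
  by rewrite (eqP (xchooseP (ex i))) (eqP (xchooseP (ex j))) -!/(h _) hij.
by apply: sep => a; rewrite -!cats1; split; apply: accepted_same_run.
Qed.

End Run.

Section Witness.
Variables (m g : nat) (T : finType).
Local Notation pairs := ('I_m.+1 * 'I_g.+1)%type.
Variable S : pairs -> {set T}.
Local Notation Sigma := (option (option T)).

(** The default is reached in [witness_delta] only when [None] is read at the last pair, and
    [run_witness] stops before that. *)
Definition nth_pair i : pairs := nth (ord0, ord0) (enum [set: pairs]) i.

(* The letter [Some None] is there to give every residual a word of length one,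
   whatever [S] is. *)
Definition witness_delta (q : 'I_m.+1) (A : 'I_g.+1) (a : Sigma) :
    {fset ('I_m.+1 * seq 'I_g.+1)} :=
  match a with
  | None => let x := nth_pair (index (q, A) (enum [set: pairs])).+1 in
            [fset (x.1, [:: x.2])]%fset
  | Some None => [fset (ord0, [::])]%fset
  | Some (Some t) => if t \in S (q, A) then [fset (ord0, [::])]%fset else fset0
  end.

Lemma witness_input_nonempty : 0 < #|{: Sigma}|.
Proof. by rewrite card_option. Qed.

Lemma witness_deterministic q A a : #|` witness_delta q A a| <= 1.
Proof. by case: a => [[t|]|] /=; try case: ifP; rewrite ?cardfs1 ?cardfs0. Qed.

Lemma witness_initial_shape (x : 'I_g.+1) :
  if #|'I_m.+1| == 1 then 0 < size [:: x] else size [:: x] == 1.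
Proof. by case: ifP. Qed.

Definition witness : rpda Sigma :=
  @RPDA Sigma 'I_m.+1 'I_g.+1 witness_delta (nth_pair 0).1 [:: (nth_pair 0).2]
    [set ord0] witness_input_nonempty witness_deterministic
    (witness_initial_shape _).

Lemma run_witness i : i < #|{: pairs}| ->
  run (M := witness) (start witness, initial witness) (nseq i None) =
  Some ((nth_pair i).1, [:: (nth_pair i).2]).
Proof.
(* The last letter is split off, since the induction hypothesis concerns runs from the start. *)
elim: i => [//|i IHi] lti; rewrite -addn1 nseqD run_cat IHi 1?ltnW //=.
rewrite /move_on /= -surjective_pairing index_uniq ?enum_uniq ?addn1 //.
  by rewrite ohead_fset1.
by rewrite -cardE cardsT ltnW.
Qed.

Definition access (x : pairs) : seq Sigma :=
  nseq (index x (enum [set: pairs])) None.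

Lemma run_access x :
  run (M := witness) (start witness, initial witness) (access x) =
  Some (x.1, [:: x.2]).
Proof.
rewrite run_witness; last by rewrite -cardsT cardE index_mem mem_enum inE.
by rewrite /nth_pair nth_index // mem_enum inE.
Qed.

Lemma accepted_access_mark x : accepted witness (rcons (access x) (Some None)).
Proof.
apply/acceptedE; exists ord0; first by rewrite inE.
by rewrite -cats1 run_cat run_access /= /move_on /= ohead_fset1.
Qed.

Lemma accepted_access x t :
  accepted witness (rcons (access x) (Some (Some t))) <-> t \in S x.
Proof.
rewrite acceptedE -cats1 run_cat run_access /= /move_on /=.
rewrite -surjective_pairing; case: ifP => _.
  by split=> // _; exists ord0; rewrite ?inE // ohead_fset1.
by split=> [[f _]|//].
Qed.

(** The letters [Some (Some t)] recover [S x] from the residual of [access x], so injectivity of [S]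
    keeps these residuals distinct. *)
Lemma witness_card_bound (M : rpda Sigma) : injective S ->
  accepted M = accepted witness -> m.+1 * g.+1 <= #|state M| * #|stack M|.
Proof.
move=> injS eqL; rewrite -[m.+1]card_ord -[g.+1]card_ord -(card_prod 'I_m.+1).
apply: (@card_residuals _ M _ access (Some None)) => [x|x y sub].
  by rewrite eqL; apply: accepted_access_mark.
apply/injS/setP=> t; move: (sub (Some (Some t))); rewrite eqL !accepted_access.
by move=> xy; apply/idP/idP=> /xy.
Qed.

End Witness.

Lemma exists_injective_subsets (I : finType) r : #|I| <= 2 ^ r ->
  exists S : I -> {set 'I_r}, injective S.
Proof.
have <- : #|{set 'I_r}| = 2 ^ r.
  by rewrite -cardsT -powersetT card_powerset cardsT card_ord.
move=> leI.
exists (fun x => enum_val (widen_ord leI (enum_rank x))) => x y.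
by move=> /enum_val_inj /(congr1 val) /= /val_inj /enum_rank_inj.
Qed.

Lemma mul_leq_exp2 m n : exists r, m * (r + n) <= 2 ^ r.
Proof.
have cube k : k ^ 3 <= 2 ^ (3 * k).
  by rewrite (mulnC 3) expnM leq_exp2r // ltnW // ltn_expl.
(* With [k = m + n + 4], one has [m <= k] and [3 * k + n <= 4 * k <= k ^ 2], so the product is at
   most [k ^ 3]. *)
exists (3 * (m + n).+4); apply: leq_trans (cube _).
by rewrite expnS leq_mul //; nia.
Qed.

Theorem theorem5 (m n : nat) (hm : 1 <= m) :
  family_proper (niRPDA m n) (niRPDA m n.+1).
Proof.
split=> [Sigma L [M [cardM limM ->]]|sub].
  by exists M; split=> //; apply: leqW.
case: m hm sub => // m _ sub.
(* The alphabet will have [r + 2] letters, so [r + n + 3] pushdown symbols exceed it by exactly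
   [n + 1]. The choice of [r] leaves enough subsets of the [r] test letters for all pairs. *)
have [r ler] := mul_leq_exp2 m.+1 n.+3.
have [|S injS] := @exists_injective_subsets ('I_m.+1 * 'I_(r + n.+2).+1)%type r.
  by rewrite card_prod !card_ord -addnS.
have cardSigma : #|{: option (option 'I_r)}| = r.+2.
  by rewrite !card_option card_ord.
have [|M [cardM limM eqL]] := sub _ (accepted (witness S)).
  exists (witness S); split=> //=; first by rewrite card_ord.
  by rewrite /non_input_limited /= card_ord cardSigma; lia.
(* The equal state counts cancel: [M] would need [r + n + 3] pushdown symbols, but [limM] allows at
   most [r + 2 + n]. *)
have := witness_card_bound injS (esym eqL); rewrite cardM leq_mul2l /=.
move: limM; rewrite /non_input_limited cardSigma leq_subLR => leM.
by apply/negP; rewrite -leqNgt (leq_trans leM) //; lia.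
Qed.
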